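(* Let $A,X,U$ be Banach spaces with $U\subseteq X$, let $\mathcal{A},\mathcal{M}_k$ ($k\ge1$) be linear operators from $L_1((0,T);A)$ to $L_1((0,T);X)$, and consider the equation $du=(\mathcal{A}u+f)dt+(\mathcal{M}_ku+g_k)dw_k$, $u|_{t=0}=u_0$, with $u_0$ a $U$-valued generalized random element and $f,g_k$ $X$-valued generalized random processes. Assume (1) for every $v_0\in U$ and $\varphi\in L_1((0,T);X)$, the equation $v(t)=v_0+\int_0^t(\mathcal{A}v)(s)ds+\int_0^t\varphi(s)ds$ has a unique $w(A,X)$ solution $v(t)=V(t,v_0,\varphi)$; (2) $g_k=0$ for all $k$, and $f_\alpha=u_{0,\alpha}=0$ whenever $|\alpha|>0$. Let $u_{(0)}(t)=V(t,u_{0,(0)},f_{(0)})$ be the solution of the propagator for $\alpha=(0)$ (the zero multi-index). For $\alpha\in\mathcal{J}$ with $|\alpha|=n\ge1$ and characteristic set $K_\alpha=\{(i_1,k_1),\dots,(i_n,k_n)\}$ define $F^n(t;\alpha)$ inductively by $F^1(t;\alpha)=V(t,0,m_i\mathcal{M}_ku_{(0)})$ if $K_\alpha=\{(i,k)\}$, and $F^n(t;\alpha)=\sum_{j=1}^nV\big(t,0,m_{i_j}\mathcal{M}_{k_j}F^{n-1}(\cdot;\alpha^-(i_j,k_j))\big)$. Then the coefficients of the (unique) $w(A,X)$ Wiener chaos solution satisfy $u_\alpha(t)=\frac{1}{\sqrt{\alpha!}}F^n(t;\alpha)$ for $|\alpha|=n\ge1$.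
   Context: Setup: independent standard Wiener processes $w_k$; $T\in(0,\infty)$; orthonormal basis $\{m_i\}$ of $L_2((0,T))$ with $m_i\in L_\infty$; $\mathcal{J}$ the multi-indices $\alpha=(\alpha_i^k)_{i,k\ge1}$ of nonnegative integers with finitely many nonzero entries, $|\alpha|=\sum\alpha_i^k$, $\alpha!=\prod\alpha_i^k!$; $\xi_\alpha=(\alpha!)^{-1/2}\prod H_{\alpha_i^k}(\int_0^Tm_i\,dw_k)$ (Hermite polynomials). Generalized random elements/processes are formal series $\sum_\alpha u_\alpha\xi_\alpha$ with $u_\alpha$ in $X$ (resp. $L_1((0,T);X)$). $\alpha^-(i,k)$ equals $\alpha$ except its $(i,k)$ entry is $\max(\alpha_i^k-1,0)$. A $w(A,X)$ solution of the deterministic equation is $v\in L_1((0,T);A)$ satisfying it in $L_1((0,T);X)$. A $w(A,X)$ Wiener chaos solution is an $A$-valued generalized random process $u$ with $u_\alpha\in L_1((0,T);A)$ satisfying, for every $\alpha$, the propagator $u_\alpha(t)=u_{0,\alpha}+\int_0^t(\mathcal{A}u_\alpha+f_\alpha)ds+\int_0^t\sum_{i,k}\sqrt{\alpha_i^k}(\mathcal{M}_ku_{\alpha^-(i,k)}+g_{k,\alpha^-(i,k)})m_i\,ds$ in $L_1((0,T);X)$. Characteristic set: for $|\alpha|=n$, $K_\alpha=\{(i_1,k_1),\dots,(i_n,k_n)\}$ is the list of pairs in which each pair $(i,k)$ with $\alpha_i^k>0$ appears exactly $\alpha_i^k$ times, ordered so that $i_1\le\dots\le i_n$ and $k_j\le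 k_{j+1}$ whenever $i_j=i_{j+1}$. *)

(* Defs.v *)
From HB Require Import structures.
From mathcomp Require Import all_boot all_order all_algebra.
From mathcomp Require Import finmap.
From mathcomp Require Import all_classical all_reals all_analysis.
Set Implicit Arguments. Unset Strict Implicit. Unset Printing Implicit Defensive.
Import Order.TTheory GRing.Theory Num.Theory.
Import numFieldNormedType.Exports.
Local Open Scope classical_set_scope.
Local Open Scope ring_scope.

(** * Multi-indices
   A multi-index alpha = (alpha_i^k) is a finitely supported function
   nat * nat -> nat; the pair p = (i, k) (i = index of the basis m_i,
   k = index of the Wiener process w_k).  Indices are 0-based. *)
Definition mindex := {fsfun nat * nat -> nat with 0%N}.

Definition mzero : mindex := [fsfun].

Definition mabs (a : mindex) : nat := (\sum_(p <- finsupp a) a p)%N.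
Definition mfact (a : mindex) : nat := (\prod_(p <- finsupp a) (a p)`!)%N.
Definition mdec (a : mindex) (p : nat * nat) : mindex :=
  [fsfun a with p |-> (a p).-1].

Definition pair_le (p q : nat * nat) : bool :=
  (p.1 < q.1)%N || ((p.1 == q.1) && (p.2 <= q.2)%N).

Definition charset (a : mindex) : seq (nat * nat) :=
  sort pair_le (flatten [seq nseq (a p) p | p <- finsupp a]).

Section Bochner.
Variable R : realType.
Local Notation mu := (@lebesgue_measure R).

Definition ae_on (D : set R) (P : R -> Prop) : Prop :=
  {ae mu, forall t, D t -> P t}.

Definition ae_equal (V : Type) (D : set R) (f g : R -> V) : Prop :=
  ae_on D (fun t => f t = g t).

Variable X : normedModType R.

Definition simple_on (D : set R) (s : R -> X) : Prop :=
  finite_set (s @` D) /\ forall x : X, measurable (D `&` s @^-1` [set x]).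

Definition strongly_measurable (D : set R) (f : R -> X) : Prop :=
  exists s : nat -> R -> X, (forall n, simple_on D (s n)) /\
    ae_on D (fun t => (fun n => s n t) @ \oo --> f t).

Definition bochner_integrable (D : set R) (f : R -> X) : Prop :=
  strongly_measurable D f /\ (\int[mu]_(t in D) (`|f t|)%:E < +oo)%E.

(* x is the Bochner integral of f over D (characterized through continuous
   linear functionals, which commute with the Bochner integral and separate
   points by Hahn-Banach) *)
Definition is_bintegral (D : set R) (f : R -> X) (x : X) : Prop :=
  bochner_integrable D f /\
  forall phi : {linear X -> R^o}, continuous phi ->
    ((phi x)%:E = \int[mu]_(t in D) (phi (f t))%:E)%E.

Definition bint (D : set R) (f : R -> X) : X :=
  xget 0 [set x | is_bintegral D f x].

End Bochner.

Section Setting.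
Variables (R : realType) (A X U : completeNormedModType R).
Variables (iA : A -> X) (iU : U -> X) (T : R).

Local Notation I := `]0%R, T[%classic.

Definition L1 (Y : normedModType R) (v : R -> Y) := bochner_integrable I v.

(* a linear operator L_1((0,T);A) -> L_1((0,T);X), acting on representatives *)
Definition L1_operator (Op : (R -> A) -> (R -> X)) : Prop :=
  [/\ (forall v, L1 v -> L1 (Op v)),
      (forall v1 v2, L1 v1 -> L1 v2 -> ae_equal I v1 v2 -> ae_equal I (Op v1) (Op v2)) &
      (forall (a : R) v1 v2, L1 v1 -> L1 v2 ->
         ae_equal I (Op (fun s => a *: v1 s + v2 s)) (fun s => a *: Op v1 s + Op v2 s))].

Definition wsol (Aop : (R -> A) -> (R -> X)) (v0 : U) (phi : R -> X)
    (v : R -> A) : Prop :=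
  L1 v /\ ae_on I (fun t => iA (v t) =
    iU v0 + bint `[0%R, t] (Aop v) + bint `[0%R, t] phi).

Definition solution_operator (Aop : (R -> A) -> (R -> X))
    (V : U -> (R -> X) -> (R -> A)) : Prop :=
  forall v0 phi, L1 phi ->
    wsol Aop v0 phi (V v0 phi) /\
    forall v, wsol Aop v0 phi v -> ae_equal I v (V v0 phi).

(* w(A,X) Wiener chaos solution, given by its coefficients u_alpha *)
Definition wc_solution (Aop : (R -> A) -> (R -> X))
    (Mop : nat -> (R -> A) -> (R -> X)) (m : nat -> R -> R)
    (u0 : mindex -> U) (f : mindex -> R -> X) (g : nat -> mindex -> R -> X)
    (u : mindex -> R -> A) : Prop :=
  forall a : mindex, L1 (u a) /\
    ae_on I (fun t => iA (u a t) =
      iU (u0 a) + bint `[0%R, t] (fun s => Aop (u a) s + f a s)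
      + bint `[0%R, t] (fun s => \sum_(p <- finsupp a)
           (Num.sqrt ((a p)%:R : R) * m p.1 s) *:
             (Mop p.2 (u (mdec a p)) s + g p.2 (mdec a p) s))).

Definition ONB_Linfty (m : nat -> R -> R) : Prop :=
  [/\ (forall i, measurable_fun I (m i)),
      (forall i, exists C : R, ae_on I (fun t => `|m i t| <= C)),
      (forall i j, (\int[@lebesgue_measure R]_(t in I) (m i t * m j t)%:E
                    = ((i == j)%:R : R)%:E)%E) &
      (forall h : R -> R, measurable_fun I h ->
         (\int[@lebesgue_measure R]_(t in I) (h t ^+ 2)%:E < +oo)%E ->
         (forall i, (\int[@lebesgue_measure R]_(t in I) (h t * m i t)%:E = 0)%E) ->
         ae_on I (fun t => h t = 0))].

(* F^n(t; alpha); F^0 is u_(0) = V(t, u_{0,(0)}, f_(0)) so that the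
   recursion for n = 1 gives F^1(t;alpha) = V(t, 0, m_i M_k u_(0)) *)
Fixpoint Fn (V : U -> (R -> X) -> (R -> A)) (Mop : nat -> (R -> A) -> (R -> X))
    (m : nat -> R -> R) (u0 : mindex -> U) (f : mindex -> R -> X)
    (n : nat) (a : mindex) : R -> A :=
  match n with
  | 0 => V (u0 mzero) (f mzero)
  | n'.+1 => fun t => \sum_(p <- charset a)
      V 0 (fun s => m p.1 s *: Mop p.2 (Fn V Mop m u0 f n' (mdec a p)) s) t
  end.

End Setting.

(* Main.v *)
Require Import Defs.
From HB Require Import structures.
From mathcomp Require Import all_boot all_order all_algebra.
From mathcomp Require Import finmap ring lra.
From mathcomp Require Import all_classical all_reals all_analysis.
From mathcomp Require Import measurable_realfun.
Set Implicit Arguments. Unset Strict Implicit. Unset Printing Implicit Defensive.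
Import Order.TTheory GRing.Theory Num.Theory.
Import numFieldNormedType.Exports.
Local Open Scope classical_set_scope.
Local Open Scope ring_scope.

(* Uniqueness of the deterministic problem makes [V 0] linear up to null sets.
   For [|a| = n + 1] the propagator then reads [u a = V 0 phi] with
   [phi = \sum_p sqrt (a p) m_p M_p (u (a - p))]; inserting the induction
   hypothesis and [a! = a_p (a - p)!], i.e.
   [sqrt a_p / sqrt (a - p)! = a_p / sqrt a!], and pulling the sum out of [V 0]
   gives [1 / sqrt a!] times the recursion for [F].

   Linearity of [V] rests on linearity of [bint], which is specified only
   through continuous functionals and is [0] where no integral exists.  Its
   uniqueness is the Hahn-Banach theorem; its existence follows by
   approximating with dominated simple functions, where a norming functional
   turns [phi x = \int phi f] into [|x| <= \int |f|]. *)

(** * Hahn-Banach *)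

Section HahnBanach.
Context {R : realType} {X : normedModType R}.
Implicit Types (G : set (X * R)) (x y z : X).

(** A linear functional on a subspace, encoded by its graph so that extensions are ordered by
    inclusion. The bound is one-sided; applying it at [- y] gives the other side. The empty graph
    qualifies. *)
Definition norm_dominated_graph G : Prop :=
  (forall a y r z s, G (y, r) -> G (z, s) -> G (a *: y + z, a * r + s)) /\
  (forall y r, G (y, r) -> r <= `|y|).

(** The difference of two values at [y] is a value at [0], hence at most [0]; by symmetry the values
    agree. *)
Lemma norm_dominated_graph_fun G y r s :
  norm_dominated_graph G -> G (y, r) -> G (y, s) -> r = s.
Proof.
move=> [Glin Gle] yr ys; apply/eqP; rewrite eq_le.
have h p q : G (y, p) -> G (y, q) -> p <= q.
  move=> yp yq; have := Gle _ _ (Glin (-1) _ _ _ _ yq yp).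
  rewrite scaleN1r addNr normr0; lra.
by rewrite !h.
Qed.

(** One-dimensional extension step: the value [c] at [y] has to satisfy
    [s - |z - y| <= c <= |z + y| - s] for all [(z, s)] in [G]. By the triangle inequality each lower
    bound lies below each upper bound, so the supremum of the lower bounds serves. *)
Lemma norm_dominated_graph_extend G y z0 r0 :
  norm_dominated_graph G -> G (z0, r0) ->
  exists G', [/\ norm_dominated_graph G', G `<=` G' & exists r, G' (y, r)].
Proof.
move=> [Glin Gle] Gz0.
pose S := [set q : R | exists z s, G (z, s) /\ q = s - `|z - y|].
have G00 : G (0, 0).
  by have := Glin (-1) _ _ _ _ Gz0 Gz0; rewrite scaleN1r mulN1r !addNr.
have GZ a z s : G (z, s) -> G (a *: z, a * s).
  by move=> zs; have := Glin a _ _ _ _ zs G00; rewrite !addr0.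
have Sub z s : G (z, s) -> ubound S (`|z + y| - s).
  move=> zs _ [z' [s' [zs' ->]]].
  have := Gle _ _ (Glin 1 _ _ _ _ zs zs'); rewrite scale1r mul1r.
  have : `|z + z'| <= `|z + y| + `|z' - y|.
    by rewrite -[z + z'](_ : (z + y) + (z' - y) = _) ?ler_normD// addrACA subrr addr0.
  lra.
have Sne : S !=set0 by exists (0 - `|0 - y|); exists 0, 0.
pose c := sup S.
have c_ge z s : G (z, s) -> s - `|z - y| <= c.
  by move=> zs; apply: ub_le_sup; [exists (`|z0 + y| - r0); exact: Sub|exists z, s].
have c_le z s : G (z, s) -> c <= `|z + y| - s.
  by move=> zs; apply: ge_sup => //; exact: Sub.
(* Dividing by [|a|] reduces the bound to the two cases [a = 1] and [a = -1], which are [c_le] and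
   [c_ge]. *)
have key a z s : G (z, s) -> s + a * c <= `|z + a *: y|.
  move=> zs; have [a0|a0|->] := ltgtP a 0; last first.
  - by rewrite mul0r addr0 scale0r addr0; exact: Gle.
  - have := c_le _ _ (GZ a^-1 _ _ zs).
    rewrite -(ler_pM2l a0) mulrBr mulrA divff ?gt_eqF// mul1r.
    rewrite -{2}(gtr0_norm a0) -normrZ scalerDr scalerA divff ?gt_eqF// scale1r.
    lra.
  - have na0 : 0 < - a by rewrite oppr_gt0.
    have := c_ge _ _ (GZ (- a)^-1 _ _ zs).
    rewrite -(ler_pM2l na0) mulrBr mulrA divff ?gt_eqF// mul1r.
    rewrite -{1}(gtr0_norm na0) -normrZ scalerBr scalerA divff ?gt_eqF// scale1r.
    rewrite scaleNr opprK; lra.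
exists [set p | exists z s a, G (z, s) /\ p = (z + a *: y, s + a * c)]; split.
- split.
  + move=> a y1 r1 y2 r2 [z1 [s1 [a1 [G1 [-> ->]]]]] [z2 [s2 [a2 [G2 [-> ->]]]]].
    exists (a *: z1 + z2), (a * s1 + s2), (a * a1 + a2); split; first exact: Glin.
    by congr pair; [rewrite scalerDr scalerA scalerDl addrACA|ring].
  + by move=> y1 r1 [z1 [s1 [a1 [G1 [-> ->]]]]]; exact: key.
- move=> [z s] zs; exists z, s, 0; split => //.
  by rewrite scale0r mul0r !addr0.
- exists c, 0, 0, 1; split => //.
  by rewrite scale1r mul1r !add0r.
Qed.

Lemma exists_norming_functional x :
  exists phi : {linear X -> R^o},
    [/\ continuous phi, phi x = `|x| & forall y, `|phi y| <= `|y|].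
Proof.
(* Zorn's lemma also requires the union of the empty chain to satisfy [P], so the value at [x] is
   prescribed only for nonempty graphs. *)
pose P G := norm_dominated_graph G /\ (G !=set0 -> G (x, `|x|)).
have [F FP Ftot|G [[Gdom Gx] Gmax]] := @Zorn_bigcup (X * R)%type P.
  split; first split.
  - move=> a y r z s [G1 FG1 G1y] [G2 FG2 G2z].
    have [G12|G21] := Ftot _ _ FG1 FG2.
      by exists G2 => //; apply: (FP _ FG2).1.1 => //; exact: G12.
    by exists G1 => //; apply: (FP _ FG1).1.1 => //; exact: G21.
  - by move=> y r [G1 FG1 G1y]; apply: (FP _ FG1).1.2.
  - move=> [p [G1 FG1 G1p]]; exists G1 => //; apply: (FP _ FG1).2.
    by exists p.
(* A maximal graph is nonempty: the graph on the line through [x] is strictly larger than the empty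
   one. *)
have {}Gx : G (x, `|x|).
  apply: contrapT => nGx.
  have G0 : G = set0.
    by apply/eqP; apply: contrapT => /negP/set0P /Gx.
  pose L := [set p : X * R | exists a, p = (a *: x, a * `|x|)].
  have Lx : L (x, `|x|) by exists 1; rewrite scale1r mul1r.
  apply: (Gmax L).
    by rewrite G0; split => // /(_ _ Lx).
  split => //; split.
    move=> a y r z s [b [-> ->]] [c [-> ->]]; exists (a * b + c).
    by rewrite scalerDl scalerA mulrDl mulrA.
  by move=> y r [b [-> ->]]; rewrite normrZ ler_wpM2r// ler_norm.
(* If [y] were outside the domain, the one-dimensional extension would contradict maximality. *)
have Gtot y : exists r, G (y, r).
  have [G' [G'dom GG' [r G'y]]] := norm_dominated_graph_extend y Gdom Gx.
  exists r; apply: contrapT => nGy; apply: (Gmax G').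
    by split => // /(_ _ G'y).
  by split => // _; exact: GG'.
have [phi Gphi] := choice Gtot.
have phi_lin : linear (phi : X -> R^o).
  move=> a y z; apply: (norm_dominated_graph_fun Gdom (Gphi _)).
  exact: Gdom.1.
pose phiL : {linear X -> R^o} :=
  HB.pack (phi : X -> R^o) (GRing.isLinear.Build R X R^o _ (phi : X -> R^o) phi_lin).
have phiN y : `|phiL y| <= `|y|.
  rewrite ler_norml (Gdom.2 _ _ (Gphi y)) andbT.
  have := Gdom.2 _ _ (Gphi (- y)); rewrite normrN -[phi (- y)]/(phiL (- y)) linearN /=.
  by rewrite -[phi y]/(phiL y); lra.
exists phiL; split => //.
- apply: bounded_linear_continuous; apply/linear_boundedP.
  by near=> r => y; rewrite (le_trans (phiN y))// ler_peMl.
- exact: (norm_dominated_graph_fun Gdom (Gphi _) Gx).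
Unshelve. all: by end_near.
Qed.

End HahnBanach.

(** * Lebesgue integrals of possibly non-measurable functions *)

Section IntegralAlmostEverywhere.
Context d (T : measurableType d) (R : realType) (mu : {measure set T -> \bar R}).
Implicit Types (D : set T) (f g : T -> \bar R).
Import HBNNSimple.
Local Open Scope ereal_scope.

(** The integral of a nonnegative function is a supremum over the simple functions below it, which
    makes sense for every function. It thus suffices to make each simple function below [f] lie
    below [g] at no cost to its integral. *)
Lemma nonmeas_ge0_le_integral D D' f g :
  (forall x, D x -> 0 <= f x) -> (forall x, D' x -> 0 <= g x) ->
  {ae mu, forall x, (f \_ D) x <= (g \_ D') x} ->
  \int[mu]_(x in D) f x <= \int[mu]_(x in D') g x.
Proof.
move=> f0 g0 [N [mN N0 sN]]; rewrite !ge0_integralE//.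
apply: ge_ereal_sup => _ [h /= hf <-].
(* [h'] is [h] set to [0] on the exceptional null set: same integral, and below [g] everywhere. *)
pose h' := proj_nnsfun h (measurableC mN).
have h'E x : (h' x)%:E = if x \in N then 0 else (h x)%:E.
  by rewrite -mrestrict patchE in_setC; case: (x \in N).
apply: (@le_trans _ _ (sintegral mu h')).
  have := @integral_nnsfun _ _ R mu _ measurableT h; rewrite patch_setT => <-.
  have := @integral_nnsfun _ _ R mu _ measurableT h'; rewrite patch_setT => <-.
  rewrite le_eqVlt; apply/orP; left; apply/eqP.
  apply: ge0_ae_eq_integral => //.
  - exact/measurable_EFinP.
  - exact/measurable_EFinP.
  - by move=> x _; rewrite lee_fin.
  - by move=> x _; rewrite lee_fin.
  exists N; split => // x /= /not_implyP[_].
  by rewrite h'E; case: ifPn => [/set_mem//|].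
apply: ereal_sup_ubound; exists h' => //= x.
rewrite h'E; case: ifPn => [_|xN].
  by apply: erestrict_ge0.
apply: (le_trans (hf x)); apply: contrapT => nle.
by move/negP: xN; apply; apply/mem_set/sN.
Qed.

Lemma nonmeas_ae_eq_integral D f g : ae_eq mu D f g ->
  \int[mu]_(x in D) f x = \int[mu]_(x in D) g x.
Proof.
move=> fg; rewrite integralE [RHS]integralE.
have h (h1 h2 : T -> \bar R) : (forall x, 0 <= h1 x) -> (forall x, 0 <= h2 x) ->
    ae_eq mu D h1 h2 -> \int[mu]_(x in D) h1 x = \int[mu]_(x in D) h2 x.
  move=> h10 h20 h12; apply/eqP; rewrite eq_le; apply/andP; split;
    apply: nonmeas_ge0_le_integral => //; apply: filterS h12 => x h12;
    by rewrite !patchE; case: ifPn => // /set_mem /h12 ->.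
by move/ae_eq_funeposneg : fg => [fgp fgn]; congr (_ - _); apply: h.
Qed.

End IntegralAlmostEverywhere.

(** * Simple functions and their limits *)

Section SimpleFunctions.
Context {R : realType}.
Local Notation mu := (@lebesgue_measure R).
Implicit Types (D : set R).

(** Each level set of the composite is a finite union, over pairs of values, of intersections of
    level sets of [s] and [t]. *)
Lemma simple_on_comp2 (X Y Z : normedModType R) (F : X -> Y -> Z) D s t :
  simple_on D s -> simple_on D t -> simple_on D (fun r => F (s r) (t r)).
Proof.
move=> [fs ms] [ft mt]; split.
  apply: (@sub_finite_set _ _ ((fun p => F p.1 p.2) @` ((s @` D) `*` (t @` D)))).
    by move=> _ [r Dr <-]; exists (s r, t r) => //; split; exists r.
  by apply: finite_image; exact: finite_setX.
move=> z.
rewrite (_ : _ `&` _ = \bigcup_(p in ((s @` D) `*` (t @` D)) `&` [set p | F p.1 p.2 = z])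
    ((D `&` s @^-1` [set p.1]) `&` (D `&` t @^-1` [set p.2]))).
  apply: fin_bigcup_measurable => [|p _]; last exact: measurableI.
  by apply: finite_setIl; exact: finite_setX.
apply/seteqP; split => [r [Dr Fz]|r [[x y] /= [_ Fz] [[Dr sx] [_ ty]]]].
  by exists (s r, t r) => //; split => //; split; exists r.
by split => //=; rewrite sx ty.
Qed.

Lemma simple_on_cst (X : normedModType R) D (c : X) :
  measurable D -> simple_on D (fun=> c).
Proof.
move=> mD; split.
  by apply: (sub_finite_set _ (finite_set1 c)) => _ [r _ <-].
move=> x; rewrite preimage_cst; case: ifPn => _; first by rewrite setIT.
by rewrite setI0.
Qed.

Lemma simple_on_indic D (E : set R) : measurable D -> measurable E ->
  simple_on (X := R^o) D \1_E.
Proof.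
move=> mD mE; split.
  apply: (@sub_finite_set _ _ [set 0; 1]) => [_ [r _ <-]|]; last exact: finite_set2.
  by rewrite indicE; case: (r \in E); [right|left].
move=> x; apply: measurableI => //.
by rewrite -[X in measurable X]setTI; apply: measurable_indic.
Qed.

Lemma simple_on_measurable D (s : R -> R) :
  simple_on (X := R^o) D s -> measurable_fun D s.
Proof.
move=> [fs ms] mD B mB.
rewrite (_ : _ `&` _ = \bigcup_(x in (s @` D) `&` B) (D `&` s @^-1` [set x])).
  by apply: fin_bigcup_measurable => [|x _]; [exact: finite_setIl|exact: ms].
apply/seteqP; split => [r [Dr Br]|r [x [_ Bx] [Dr sx]]].
  by exists (s r) => //; split => //; exists r.
by split => //=; rewrite sx.
Qed.

Lemma simple_on_sub (X : normedModType R) D E (s : R -> X) :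
  measurable E -> E `<=` D -> simple_on D s -> simple_on E s.
Proof.
move=> mE ED [fs ms]; split.
  by apply: sub_finite_set fs; exact: image_subset.
move=> x; rewrite (_ : _ `&` _ = E `&` (D `&` s @^-1` [set x])).
  exact: measurableI.
by rewrite setIA (setIidl ED).
Qed.

Lemma simple_on_patch (X : normedModType R) D N (s : R -> X) :
  measurable D -> measurable N ->
  simple_on (D `\` N) s -> simple_on D (fun t => if t \in N then 0 else s t).
Proof.
move=> mD mN [fs ms]; split.
  apply: (@sub_finite_set _ _ (s @` (D `\` N) `|` [set 0])).
    move=> _ [r Dr <-]; case: ifPn => [_|/negP rN]; [by right|left].
    by exists r => //; split => // Nr; apply: rN; exact: mem_set.
  by rewrite finite_setU; split.
move=> x; rewrite (_ : _ `&` _ = ((D `\` N) `&` s @^-1` [set x]) `|`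
   (if x == 0 then D `&` N else set0)).
  by apply: measurableU => //; case: ifP => // _; exact: measurableI.
apply/seteqP; split => r /=.
  move=> [Dr]; case: ifPn => [/set_mem Nr <-|/negP rN <-].
    by right; rewrite eqxx.
  by left; split => //; split => // Nr; apply: rN; exact: mem_set.
move=> [[[Dr Nr] <-]|].
  by split => //; rewrite memNset.
by case: eqP => // -> [Dr Nr]; split => //; rewrite mem_set.
Qed.

End SimpleFunctions.

(** * Measurability of pointwise limits of simple functions *)

Section Measurability.
Import HBSimple.
Context {R : realType}.
Local Notation mu := (@lebesgue_measure R).
Implicit Types (D : set R).

(* Strong measurability without an exceptional null set. *)
Definition simple_limit (X : normedModType R) D (f : R -> X) : Prop :=
  exists s : nat -> R -> X, (forall n, simple_on D (s n)) /\
    forall t, D t -> (fun n => s n t) @ \oo --> f t.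

(** The common source of the closure properties below: norms, continuous functionals, linear
    combinations and products with scalar functions. *)
Lemma simple_limit_comp2 (X Y Z : normedModType R) (F : X -> Y -> Z) D f g :
  (forall t, D t -> forall (u : nat -> X) (v : nat -> Y), u @ \oo --> f t -> v @ \oo --> g t ->
    (fun n => F (u n) (v n)) @ \oo --> F (f t) (g t)) ->
  simple_limit D f -> simple_limit D g -> simple_limit D (fun t => F (f t) (g t)).
Proof.
move=> Fc [s [ss sf]] [t [st tg]]; exists (fun n r => F (s n r) (t n r)); split.
  by move=> n; exact: simple_on_comp2.
by move=> r Dr; apply: Fc => //; [exact: sf|exact: tg].
Qed.

Lemma simple_limit_measurable D (f : R -> R) :
  simple_limit (X := R^o) D f -> measurable_fun D f.
Proof.
move=> [s [ss sf]]; apply: (measurable_fun_cvg (h := s)) => // n.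
exact: simple_on_measurable.
Qed.

Lemma measurable_simple_limit D (f : R -> R) : measurable D ->
  measurable_fun D f -> simple_limit (X := R^o) D f.
Proof.
move=> mD mf; have mf' : measurable_fun D (EFin \o f) by exact/measurable_EFinP.
have [g gf] := approximation_sfun mD mf'.
exists (fun n r => g n r); split.
  move=> n; split; last by move=> x; apply: measurableI => //; exact: measurable_sfunP.
  by apply: sub_finite_set (fimfunP (g n)); exact: image_subset.
move=> t Dt; have := gf t Dt => /fine_cvgP[_]. 
exact.
Qed.

Lemma simple_limit_norm (X : normedModType R) D (f : R -> X) :
  simple_limit D f -> measurable_fun D (fun t => `|f t|).
Proof.
move=> sf; apply: simple_limit_measurable.
apply: (simple_limit_comp2 (F := fun x _ : X => `|x| : R^o) _ sf sf).
by move=> t _ u v uf _; exact: cvg_norm.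
Qed.

Lemma simple_limit_functional (X : normedModType R) D (f : R -> X)
    (phi : {linear X -> R^o}) : continuous phi ->
  simple_limit D f -> measurable_fun D (fun t => phi (f t)).
Proof.
move=> cphi sf; apply: simple_limit_measurable.
apply: (simple_limit_comp2 (F := fun x _ : X => phi x) _ sf sf).
by move=> t _ u v uf _; apply: continuous_cvg => //; exact: cphi.
Qed.

Lemma simple_limit_lin (X : normedModType R) D (a : R) (f g : R -> X) :
  simple_limit D f -> simple_limit D g -> simple_limit D (fun t => a *: f t + g t).
Proof.
apply: (simple_limit_comp2 (F := fun x y : X => a *: x + y)).
by move=> t _ u v uf vg; apply: cvgD => //; exact: cvgZr.
Qed.

Lemma simple_limit_scale (X : normedModType R) D (m : R -> R) (f : R -> X) :
  simple_limit (X := R^o) D m -> simple_limit D f ->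
  simple_limit D (fun t => m t *: f t).
Proof.
apply: (simple_limit_comp2 (F := fun (x : R^o) (y : X) => (x : R) *: y)).
by move=> t _ u v uf vg; exact: cvgZ.
Qed.

End Measurability.

(** * Bochner integrals *)

Section BochnerIntegral.
Context {R : realType}.
Local Notation mu := (@lebesgue_measure R).
(* Measurability in the structure carrying [lebesgue_measure]: same sets as
   [measurable] on [R], but a different display, which blocks unification. *)
Local Notation lmeasurable := (@measurable _ (measurableTypeR R)).
Implicit Types (D : set R).

Lemma ae_onS D (P Q : R -> Prop) :
  (forall t, D t -> P t -> Q t) -> ae_on D P -> ae_on D Q.
Proof.
rewrite /ae_on /prop_near1 => PQ aP.
by apply: (@filterS _ (almost_everywhere mu) _ _ _ _ aP) => t Pt Dt; exact: PQ (Pt Dt).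
Qed.

Lemma ae_onS2 D (P Q S : R -> Prop) :
  (forall t, D t -> P t -> Q t -> S t) -> ae_on D P -> ae_on D Q -> ae_on D S.
Proof.
rewrite /ae_on /prop_near1 => PQS aP aQ.
apply: (@filterS2 _ (almost_everywhere mu) _ _ _ _ _ aP aQ) => t Pt Qt Dt.
exact: PQS (Pt Dt) (Qt Dt).
Qed.

Lemma ae_onW D (P : R -> Prop) : (forall t, D t -> P t) -> ae_on D P.
Proof. by move=> DP; apply: aeW. Qed.

Lemma ae_equal_sym (V : Type) D (f g : R -> V) : ae_equal D f g -> ae_equal D g f.
Proof. by apply: ae_onS => t Dt ->. Qed.

Lemma ae_equal_trans (V : Type) D (f g h : R -> V) :
  ae_equal D f g -> ae_equal D g h -> ae_equal D f h.
Proof. by apply: ae_onS2 => t Dt -> ->. Qed.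

Lemma ae_equal_comp (V W : Type) (F : R -> V -> W) D (f g : R -> V) :
  ae_equal D f g -> ae_equal D (fun t => F t (f t)) (fun t => F t (g t)).
Proof. by apply: ae_onS => t Dt ->. Qed.

Lemma ae_equal_comp2 (V W Z : Type) (F : V -> W -> Z) D f g f' g' :
  ae_equal D f g -> ae_equal D f' g' ->
  ae_equal D (fun t => F (f t) (f' t)) (fun t => F (g t) (g' t)).
Proof. by apply: ae_onS2 => t Dt -> ->. Qed.

Lemma ae_equal_integral D (f g : R -> R) : ae_equal D f g ->
  (\int[mu]_(t in D) (f t)%:E = \int[mu]_(t in D) (g t)%:E)%E.
Proof.
by move=> fg; apply: nonmeas_ae_eq_integral; apply: (ae_equal_comp (fun=> EFin) fg).
Qed.

Section Space.
Context {X : normedModType R}.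
Implicit Types (f g : R -> X) (x y : X).

(** Setting both [f] and its approximants to [0] on the exceptional null set makes the convergence
    hold everywhere. *)
Lemma strongly_measurable_representative D f : lmeasurable D ->
  strongly_measurable D f -> exists2 g, ae_equal D f g & simple_limit D g.
Proof.
move=> mD [s [ss [N [mN N0 sN]]]].
exists (fun t => if t \in N then 0 else f t).
  exists N; split => // t /= /not_implyP[_].
  by case: ifPn => // /set_mem.
exists (fun n t => if t \in N then 0 else s n t); split.
  move=> n; apply: simple_on_patch => //.
  by apply: (simple_on_sub _ _ (ss n)); [exact: measurableD|exact: subDsetl].
move=> t Dt; case: ifPn => [_|/negP tN]; first exact: cvg_cst.
apply: contrapT => nst; apply: tN; apply/mem_set/sN => /= h.
exact: nst (h Dt).
Qed.

(** The working form of Bochner integrability: [f] itself may fail to be measurable on a null set,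
    whereas the norm and the functionals of the representative [g] are measurable and fall under the
    usual integration theory. *)
Lemma bochner_integrableP D f : lmeasurable D ->
  bochner_integrable D f <->
  exists g, [/\ ae_equal D f g, simple_limit D g &
                mu.-integrable D (fun t => (`|g t|)%:E)].
Proof.
move=> mD; split.
  move=> [mf If]; have [g fg sg] := strongly_measurable_representative mD mf.
  exists g; split => //; apply/integrableP; split.
    by apply/measurable_EFinP; exact: simple_limit_norm.
  under eq_integral do rewrite abse_EFin normr_id.
  by rewrite -(ae_equal_integral (ae_equal_comp (fun=> Num.norm) fg)).
move=> [g [fg [s [ss sg]] /integrableP[mg]]].
under eq_integral do rewrite abse_EFin normr_id.
rewrite -(ae_equal_integral (ae_equal_comp (fun=> Num.norm) fg)) => If.
split => //; exists s; split => //.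
by apply: ae_onS fg => t Dt ->; exact: sg.
Qed.

Lemma bochner_integrable_ae D f g : lmeasurable D ->
  ae_equal D f g -> bochner_integrable D f -> bochner_integrable D g.
Proof.
move=> mD fg /(bochner_integrableP _ mD)[h [fh sh ih]].
apply/(bochner_integrableP _ mD); exists h; split => //.
exact: ae_equal_trans (ae_equal_sym fg) fh.
Qed.

Lemma bochner_integrable_lin D (a : R) f g : lmeasurable D ->
  bochner_integrable D f -> bochner_integrable D g ->
  bochner_integrable D (fun t => a *: f t + g t).
Proof.
move=> mD /(bochner_integrableP _ mD)[f' [ff' sf If]].
move=> /(bochner_integrableP _ mD)[g' [gg' sg Ig]].
apply/(bochner_integrableP _ mD); exists (fun t => a *: f' t + g' t); split.
- exact: (ae_equal_comp2 (fun x y => a *: x + y)).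
- exact: simple_limit_lin.
have IG := integrableD mD (integrableZl mD `|a| If) Ig.
apply: (le_integrable mD _ _ IG).
  by apply/measurable_EFinP; apply: simple_limit_norm; exact: simple_limit_lin.
move=> t Dt /=; rewrite lee_fin normr_id ger0_norm ?addr_ge0 ?mulr_ge0//.
by rewrite (le_trans (ler_normD _ _))// normrZ.
Qed.

Lemma bochner_integrable0 D : lmeasurable D -> bochner_integrable D (fun=> 0 : X).
Proof.
move=> mD; apply/(bochner_integrableP _ mD); exists (fun=> 0); split.
- exact: ae_onW.
- exists (fun _ _ => 0); split; first by move=> _; exact: simple_on_cst.
  by move=> t _; exact: cvg_cst.
- by under eq_fun do rewrite normr0; exact: integrable0.
Qed.

Lemma bochner_integrable_scale D (m : R -> R) (C : R) f : lmeasurable D ->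
  measurable_fun D m -> ae_on D (fun t => `|m t| <= C) ->
  bochner_integrable D f -> bochner_integrable D (fun t => m t *: f t).
Proof.
move=> mD mm mC /(bochner_integrableP _ mD)[g [fg sg Ig]].
have smg : simple_limit D (fun t => m t *: g t).
  by apply: simple_limit_scale => //; exact: measurable_simple_limit.
apply/(bochner_integrableP _ mD); exists (fun t => m t *: g t); split => //.
  exact: (ae_equal_comp (fun t x => m t *: x) fg).
apply/integrableP; split.
  by apply/measurable_EFinP; exact: simple_limit_norm.
have /integrableP[_] := integrableZl mD C Ig.
apply: le_lt_trans; apply: nonmeas_ge0_le_integral => //.
apply: (@filterS _ (almost_everywhere mu) _ _ _ _ mC) => t {}mC.
rewrite !patchE; case: ifPn => // /set_mem /mC {}mC.
rewrite /= lee_fin normr_id normrZ normrM normr_id ler_wpM2r//.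
by rewrite (le_trans mC)// ler_norm.
Qed.

(** Meant for [E = [0, t]], [D = (0, T)] and [N = {0}]: the smaller domain is contained in the
    larger one only up to a null set. *)
Lemma bochner_integrable_sub D E N f :
  lmeasurable D -> lmeasurable E -> lmeasurable N -> mu N = 0%E -> E `\` N `<=` D ->
  bochner_integrable D f -> bochner_integrable E f.
Proof.
move=> mD mE mN N0 END [[s [ss sf]] If]; split.
  exists (fun n t => if t \in N then 0 else s n t); split.
    move=> n; apply: simple_on_patch => //.
    by apply: (simple_on_sub _ END (ss n)); exact: measurableD.
  have Nae : {ae mu, forall t, ~ N t} by exists N; split => // t /= /contrapT.
  apply: (@filterS2 _ (almost_everywhere mu) _ _ _ _ _ sf Nae) => t {}sf Nt Et.
  by rewrite memNset//; apply: sf; exact: END.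
apply: le_lt_trans If; apply: nonmeas_ge0_le_integral => //.
exists N; split => // t /=; apply: contra_notP => Nt.
rewrite !patchE; case: ifPn => [/set_mem Et|_]; last first.
  by case: ifPn => // _; rewrite lee_fin.
by rewrite mem_set//; exact: END.
Qed.

Lemma functional_integrable D g (phi : {linear X -> R^o}) : lmeasurable D ->
  continuous phi -> simple_limit D g ->
  mu.-integrable D (fun t => (`|g t|)%:E) ->
  mu.-integrable D (fun t => (phi (g t))%:E).
Proof.
move=> mD cphi sg Ig.
have /linear_boundedP/pinfty_ex_gt0 [C C0 phiC] := continuous_linear_bounded 0 (cphi 0).
apply: (le_integrable mD _ _ (integrableZl mD C Ig)).
  by apply/measurable_EFinP; exact: simple_limit_functional.
move=> t Dt /=; rewrite lee_fin [leRHS]ger0_norm ?phiC// mulr_ge0// ltW//.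
Qed.

Lemma is_bintegral_ae D f g x : lmeasurable D ->
  ae_equal D f g -> is_bintegral D f x -> is_bintegral D g x.
Proof.
move=> mD fg [If fx]; split; first exact: bochner_integrable_ae If.
move=> phi cphi; rewrite fx//.
exact: (ae_equal_integral (ae_equal_comp (fun=> phi) fg)).
Qed.

Lemma is_bintegral_lin D (a : R) f g x y : lmeasurable D ->
  is_bintegral D f x -> is_bintegral D g y ->
  is_bintegral D (fun t => a *: f t + g t) (a *: x + y).
Proof.
move=> mD [If fx] [Ig gy]; split; first exact: bochner_integrable_lin.
move=> phi cphi.
have [f' [ff' sf If']] := (bochner_integrableP f mD).1 If.
have [g' [gg' sg Ig']] := (bochner_integrableP g mD).1 Ig.
have Iphif := functional_integrable mD cphi sf If'.
have Iphig := functional_integrable mD cphi sg Ig'.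
have /(ae_equal_comp (fun=> phi))/ae_equal_integral -> :=
  ae_equal_comp2 (fun x y => a *: x + y) ff' gg'.
rewrite linearP /= EFinD EFinM fx// gy//.
rewrite (ae_equal_integral (ae_equal_comp (fun=> phi) ff')).
rewrite (ae_equal_integral (ae_equal_comp (fun=> phi) gg')).
rewrite -integralZl// -integralD//; last exact: integrableZl.
by apply: eq_integral => t _; rewrite linearP.
Qed.

(** A functional bounded by the norm with [phi x = |x|] turns this into the scalar inequality. *)
Lemma is_bintegral_norm D f x : lmeasurable D -> is_bintegral D f x ->
  ((`|x|)%:E <= \int[mu]_(t in D) (`|f t|)%:E)%E.
Proof.
move=> mD [If fx]; have [phi [cphi phix phiN]] := exists_norming_functional x.
have [g [fg sg Ig]] := (bochner_integrableP f mD).1 If.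
rewrite -phix fx// (ae_equal_integral (ae_equal_comp (fun=> phi) fg)).
rewrite (ae_equal_integral (ae_equal_comp (fun=> Num.norm) fg)).
have mphig := simple_limit_functional cphi sg.
apply: (le_trans (lee_abs _)).
apply: (le_trans (le_abse_integral _ _ _)) => //; first exact/measurable_EFinP.
apply: ge0_le_integral => //.
- by apply/measurable_EFinP; apply: measurableT_comp.
- by apply/measurable_EFinP; apply: simple_limit_norm.
- by move=> t _; rewrite lee_fin; exact: phiN.
Qed.

Lemma is_bintegral_unique D f x y :
  is_bintegral D f x -> is_bintegral D f y -> x = y.
Proof.
move=> [_ fx] [_ fy]; apply/eqP; rewrite -subr_eq0 -normr_eq0.
have [phi [cphi <- _]] := exists_norming_functional (x - y).
rewrite linearB subr_eq0; apply/eqP; apply: EFin_inj.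
by rewrite fx// fy.
Qed.

Lemma is_bintegral_bint D f x : is_bintegral D f x -> bint D f = x.
Proof.
move=> fx; apply: (is_bintegral_unique _ fx).
exact: (@xgetPex _ 0 [set x | is_bintegral D f x] (ex_intro _ x fx)).
Qed.

(** On [D] the function [h (s t)] is a finite combination of indicators of the level sets of [s]. A
    general [h] covers both the norm and the continuous functionals. *)
Lemma simple_on_integral D (h : X -> R) (s : R -> X) :
  lmeasurable D -> (mu D < +oo)%E -> simple_on D s ->
  mu.-integrable D (fun t => (h (s t))%:E) /\
  (\int[mu]_(t in D) (h (s t))%:E =
   (\sum_(y <- fset_set (s @` D)) h y * fine (mu (D `&` s @^-1` [set y])))%:E)%E.
Proof.
move=> mD Doo [fs ms].
pose E y := D `&` s @^-1` [set y].
have hE : {in D, (fun t => (h (s t))%:E) =1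
    (fun t => \sum_(y <- fset_set (s @` D)) (h y)%:E * (\1_(E y) t)%:E)%E}.
  move=> t /set_mem Dt; rewrite (bigD1_seq (s t)) /=; last 2 first.
  - by rewrite in_fset_set// mem_set//; exists t.
  - exact: fset_uniq.
  rewrite indicE mem_set// mule1 big1 ?adde0// => y yst.
  rewrite indicE memNset ?mule0// => -[_ /= sty].
  by rewrite sty eqxx in yst.
have Efin y : (mu (E y) < +oo)%E.
  apply: le_lt_trans Doo; apply: le_measure; rewrite ?inE//.
    exact: ms.
  exact: subIsetl.
have E1 y : mu.-integrable D (fun t => (\1_(E y) t)%:E).
  apply/integrableP; split; first by apply/measurable_EFinP/measurable_indic; exact: ms.
  under eq_integral do rewrite gee0_abs ?lee_fin//.
  rewrite integral_indic//; last exact: ms.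
  by rewrite setIAC setIid; exact: Efin.
have Ey y : mu.-integrable D (fun t => (h y)%:E * (\1_(E y) t)%:E)%E.
  exact: integrableZl.
split.
  apply: (eq_integrable mD (fun t =>
    (\sum_(y <- fset_set (s @` D)) (h y)%:E * (\1_(E y) t)%:E)%E)).
    by move=> t tD; rewrite hE.
  by apply: integrable_sum.
transitivity (\int[mu]_(t in D)
    (\sum_(y <- fset_set (s @` D)) (h y)%:E * (\1_(E y) t)%:E))%E.
  by apply: eq_integral => t tD; rewrite hE.
rewrite integral_sum// -sumEFin.
apply: eq_bigr => y _; rewrite integralZl// integral_indic//; last exact: ms.
by rewrite setIAC setIid EFinM fineK// ge0_fin_numE//; exact: Efin.
Qed.

Lemma simple_on_simple_limit D (s : R -> X) : simple_on D s -> simple_limit D s.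
Proof. by move=> ss; exists (fun=> s); split => // t _; exact: cvg_cst. Qed.

Lemma simple_on_bintegral D (s : R -> X) :
  lmeasurable D -> (mu D < +oo)%E -> simple_on D s -> exists x, is_bintegral D s x.
Proof.
move=> mD Doo ss.
exists (\sum_(y <- fset_set (s @` D)) fine (mu (D `&` s @^-1` [set y])) *: y).
split.
  apply/(bochner_integrableP _ mD); exists s; split; first exact: ae_onW.
  - exact: simple_on_simple_limit.
  - exact: (simple_on_integral Num.norm mD Doo ss).1.
move=> phi cphi; rewrite (simple_on_integral phi mD Doo ss).2 linear_sum /=.
by congr EFin; apply: eq_bigr => y _; rewrite linearZ /= mulrC.
Qed.

End Space.
End BochnerIntegral.

(** * Existence of the Bochner integral *)

Section BochnerExistence.
Context {R : realType}.
Local Notation mu := (@lebesgue_measure R).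
Local Notation lmeasurable := (@measurable _ (measurableTypeR R)).
Implicit Types (D : set R).

(* Cutting a simple approximation [s n] off where [|s n| > 2 |g|] keeps
   pointwise convergence and makes it dominated by [2 |g|]. *)
Lemma simple_limit_dominated (X : normedModType R) D (g : R -> X) :
  lmeasurable D -> simple_limit D g ->
  exists s : nat -> R -> X, [/\ forall n, simple_on D (s n),
    forall t, D t -> (fun n => s n t) @ \oo --> g t &
    forall n t, D t -> `|s n t| <= 2 * `|g t|].
Proof.
move=> mD sg; have [s [ss scvg]] := sg.
pose E n := D `&` [set t | `|s n t| <= 2 * `|g t|].
have mE n : measurable (E n).
  have /(_ mD [set true]) := measurable_fun_ler
    (simple_limit_norm (simple_on_simple_limit (ss n)))
    (measurable_funM (measurable_cst (2 : R)) (simple_limit_norm sg)).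
  exact.
pose s' n t := (\1_(E n) t : R) *: s n t.
have s'le n t : D t -> `|s' n t| <= 2 * `|g t|.
  move=> Dt; rewrite /s' indicE; case: (boolP (t \in E n)) => [/set_mem[_ h]|_].
    by rewrite scale1r.
  by rewrite scale0r normr0 mulr_ge0.
exists s'; split => //.
  move=> n; apply: (simple_on_comp2 (fun (a : R^o) (x : X) => (a : R) *: x)) => //.
  exact: simple_on_indic.
(* Where [g t = 0] the domination forces [s' n t = 0]. Elsewhere [|g t - s n t| <= |g t|]
   eventually, hence [|s n t| <= 2 |g t|] and the cutoff is inactive. *)
move=> t Dt; have [g0|g0] := eqVneq (g t) 0.
  suff -> : (fun n => s' n t) = (fun=> g t) by exact: cvg_cst.
  apply/funext => n; rewrite g0; apply/eqP.
  by rewrite -normr_le0 (le_trans (s'le n t Dt))// g0 normr0 mulr0.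
have gt0 : 0 < `|g t| by rewrite normr_gt0.
apply: cvg_trans (scvg t Dt); apply: near_eq_cvg; near=> n.
rewrite /s' indicE mem_set ?scale1r//; split => //=.
have : `|g t - s n t| <= `|g t|.
  near: n; move/cvgrPdist_le: (scvg t Dt); exact.
have := ler_normD (s n t - g t) (g t); rewrite subrK distrC; lra.
Unshelve. all: by end_near.
Qed.

(** The integrals [x n] of dominated simple approximants form a Cauchy sequence, since their
    distances are controlled by the [L1] distances to [g]. Their limit is the integral: [phi (x n)]
    converges to [phi] of the limit by continuity and to the integral of [phi g] by dominated
    convergence. *)
Lemma bochner_integrable_is_bintegral (X : completeNormedModType R) D (f : R -> X) :
  lmeasurable D -> (mu D < +oo)%E -> bochner_integrable D f ->
  exists x, is_bintegral D f x.
Proof.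
move=> mD Doo If; have [g [fg sg Ig]] := (bochner_integrableP f mD).1 If.
suff [x [_ gx]] : exists x, is_bintegral D g x.
  exists x; split => // phi cphi; rewrite gx//.
  exact: (ae_equal_integral (ae_equal_sym (ae_equal_comp (fun=> phi) fg))).
have [s [ss scvg sle]] := simple_limit_dominated mD sg.
have [x xs] := choice (fun n => simple_on_bintegral mD Doo (ss n)).
have sls n := simple_on_simple_limit (ss n).
pose d n t := `|s n t - g t|.
have slsub n : simple_limit D (fun t => (-1) *: g t + s n t).
  exact: simple_limit_lin.
have dE n : d n = fun t => `|(-1) *: g t + s n t|.
  by apply/funext => t; rewrite /d scaleN1r addrC.
have md n : measurable_fun D (fun t => (d n t)%:E).
  by apply/measurable_EFinP; rewrite dE; exact: simple_limit_norm.
(* The dominating function for [d n]: [|s n - g| <= 2 |g| + |g|]. *)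
have I3g := integrableZl mD 3 Ig.
have [_ _ dcvg] : [/\ mu.-integrable D (cst 0%E),
    [sequence (\int[mu]_(t in D) `|(d n t)%:E - cst 0 t|)%E]_n @ \oo --> 0%E &
    [sequence (\int[mu]_(t in D) (d n t)%:E)%E]_n @ \oo -->
      (\int[mu]_(t in D) cst 0 t)%E].
  apply: (dominated_convergence mD _ _ _ I3g) => //.
  - apply: aeW => t Dt; apply: cvg_EFin; first exact: nearW.
    have /cvgr0_norm_lt : (fun n => s n t - g t) @ \oo --> 0.
      by apply/subr_cvg0; exact: scvg.
    move=> h; apply/cvgr0Pnorm_lt => e e0; near=> n; rewrite /= normr_id.
    by near: n; exact: h.
  - apply: aeW => t n Dt; rewrite lee_fin normr_id.
    have := sle n t Dt; have := ler_normB (s n t) (g t); rewrite /d; lra.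
have d_fin n : (\int[mu]_(t in D) (d n t)%:E \is a fin_num)%E.
  apply: integrable_fin_num => //; apply: (le_integrable mD (md n) _ I3g).
  move=> t Dt /=; rewrite lee_fin normr_id [leRHS]ger0_norm ?mulr_ge0//.
  have := sle n t Dt; have := ler_normB (s n t) (g t); rewrite /d; lra.
have {}dcvg : (fun n => fine (\int[mu]_(t in D) (d n t)%:E)) @ \oo --> 0.
  by move: dcvg; rewrite integral0 => /fine_cvgP[].
(* [x n - x k] is the integral of [s n - s k]; the norm bound and the triangle inequality through
   [g] give the estimate. *)
have xdist n k : `|x n - x k| <= fine (\int[mu]_(t in D) (d n t)%:E)
    + fine (\int[mu]_(t in D) (d k t)%:E).
  rewrite -lee_fin EFinD !fineK// distrC -scaleN1r addrC.
  apply: (le_trans (is_bintegral_norm mD (is_bintegral_lin (-1) mD (xs n) (xs k)))).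
  rewrite -ge0_integralD//; last 4 first.
  - by move=> t _; rewrite lee_fin; exact: normr_ge0.
  - exact: (md n).
  - by move=> t _; rewrite lee_fin; exact: normr_ge0.
  - exact: (md k).
  apply: ge0_le_integral => //.
  - apply/measurable_EFinP; apply: simple_limit_norm; exact: simple_limit_lin.
  - by apply: emeasurable_funD; exact: md.
  - move=> t Dt; rewrite -EFinD lee_fin /d scaleN1r.
    have := ler_distD (g t) (s k t) (s n t).
    by rewrite addrC -(distrC (g t)) => /le_trans; apply; rewrite addrC distrC.
have /cvg_ex[x0 xcvg] : cvg (x @ \oo).
  apply/cauchy_cvgP/cauchy_exP => e e0.
  have e20 : 0 < e / 2 by rewrite divr_gt0.
  have [N _ hN] : \forall n \near \oo, fine (\int[mu]_(t in D) (d n t)%:E) < e / 2.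
    move/cvgr0_norm_lt : dcvg => /(_ _ e20); apply: filterS => n.
    exact/le_lt_trans/ler_norm.
  exists (x N); exists N => // n /= Nn; rewrite -ball_normE /=.
  apply: (le_lt_trans (xdist N n)); rewrite (splitr e) ltrD//; last exact: hN.
  by apply: hN => /=.
exists x0; split.
  by apply: bochner_integrable_ae If.
move=> phi cphi.
have Iphig := functional_integrable mD cphi sg Ig.
have /linear_boundedP/pinfty_ex_gt0 [C C0 phiC] := continuous_linear_bounded 0 (cphi 0).
(* Here the dominating function is [C * 2 |g|], with [C] a bound for [phi]. *)
have [_ _ intcvg] : [/\ mu.-integrable D (fun t => (phi (g t))%:E),
    [sequence (\int[mu]_(t in D) `|(phi (s n t))%:E - (phi (g t))%:E|)%E]_n @ \oo --> 0%E &
    [sequence (\int[mu]_(t in D) (phi (s n t))%:E)%E]_n @ \oo -->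
      (\int[mu]_(t in D) (phi (g t))%:E)%E].
  apply: (dominated_convergence mD _ _ _ (integrableZl mD C (integrableZl mD 2 Ig))) => //.
  - by move=> n; apply/measurable_EFinP; exact: simple_limit_functional.
  - by apply/measurable_EFinP; exact: simple_limit_functional.
  - apply: aeW => t Dt; apply: cvg_EFin; first exact: nearW.
    by apply: continuous_cvg; [exact: cphi|exact: scvg].
  - apply: aeW => t n Dt; rewrite lee_fin (le_trans (phiC _))//.
    by rewrite ler_wpM2l ?sle// ltW.
have phix : (fun n => (phi (x n))%:E) @ \oo --> (phi x0)%:E.
  apply: cvg_EFin; first exact: nearW.
  by apply: continuous_cvg => //; exact: cphi.
apply: (cvg_unique _ phix) => //.
suff -> : (fun n => (phi (x n))%:E) = [sequence (\int[mu]_(t in D) (phi (s n t))%:E)%E]_n by [].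
by apply/funext => n /=; rewrite (xs n).2.
Unshelve. all: by end_near.
Qed.

End BochnerExistence.

(** * Linearity of [bint] *)

Section BochnerLinearity.
Context {R : realType} {X : completeNormedModType R}.
Local Notation mu := (@lebesgue_measure R).
Local Notation lmeasurable := (@measurable _ (measurableTypeR R)).
Implicit Types (D : set R) (f g : R -> X).

Lemma bintP D f : lmeasurable D -> (mu D < +oo)%E -> bochner_integrable D f ->
  is_bintegral D f (bint D f).
Proof.
move=> mD Doo /(bochner_integrable_is_bintegral mD Doo)[x fx].
by rewrite (is_bintegral_bint fx).
Qed.

Lemma bint_lin D (a : R) f g : lmeasurable D -> (mu D < +oo)%E ->
  bochner_integrable D f -> bochner_integrable D g ->
  bint D (fun t => a *: f t + g t) = a *: bint D f + bint D g.
Proof.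
move=> mD Doo If Ig; apply: is_bintegral_bint.
by apply: is_bintegral_lin => //; exact: bintP.
Qed.

(** Both functions have the same set of integrals; when it is empty, both sides are the default
    [0]. *)
Lemma bint_ae D f g : lmeasurable D -> ae_equal D f g -> bint D f = bint D g.
Proof.
move=> mD fg; rewrite /bint; congr xget; apply/seteqP; split => x /=.
  exact: is_bintegral_ae.
by apply: is_bintegral_ae => //; exact: ae_equal_sym.
Qed.

End BochnerLinearity.

(** * Multi-indices *)

Section MultiIndices.
Implicit Types (a : mindex) (p : nat * nat).

Lemma mdecE a p q : mdec a p q = if q == p then (a p).-1 else a q.
Proof. by rewrite /mdec fsfun_withE. Qed.

Lemma finsupp_mdec a p : (finsupp (mdec a p) `<=` finsupp a)%fset.
Proof.
apply/fsubsetP => q; rewrite !mem_finsupp mdecE; case: (q =P p) => [->|//].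
by case: (a p).
Qed.

Lemma mabs_mdec a p : p \in finsupp a -> mabs a = (mabs (mdec a p)).+1.
Proof.
move=> pa; have ap : (0 < a p)%N by rewrite lt0n -mem_finsupp.
rewrite /mabs (big_fsetD1 p)//= -(prednK ap) addSn; congr S.
(* If [a p = 1], then [p] leaves the support of [mdec a p]; summing over [finsupp a] instead only
   adds a zero term. *)
transitivity (\sum_(q <- finsupp a) mdec a p q)%N.
  rewrite [RHS](big_fsetD1 p)//= mdecE eqxx; congr addn.
  apply: eq_big_seq => q; rewrite in_fsetD1 => /andP[/negbTE qp _].
  by rewrite mdecE qp.
apply/esym/big_fset_incl; first exact: finsupp_mdec.
by move=> q _ /fsfun_dflt.
Qed.

Lemma mfact_mdec a p : p \in finsupp a -> mfact a = (a p * mfact (mdec a p))%N.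
Proof.
move=> pa; have ap : (0 < a p)%N by rewrite lt0n -mem_finsupp.
rewrite /mfact (big_fsetD1 p)//= -{1}(prednK ap) factS (prednK ap) -mulnA.
(* As for the sum, a possible extra factor at [p] is [0! = 1]. *)
congr muln; transitivity (\prod_(q <- finsupp a) (mdec a p q)`!)%N.
  rewrite [RHS](big_fsetD1 p)//= mdecE eqxx; congr muln.
  apply: eq_big_seq => q; rewrite in_fsetD1 => /andP[/negbTE qp _].
  by rewrite mdecE qp.
apply/esym/big_fset_incl; first exact: finsupp_mdec.
by move=> q _ /fsfun_dflt ->.
Qed.

Lemma mfact_gt0 a : (0 < mfact a)%N.
Proof. by apply: prodn_gt0 => p; exact: fact_gt0. Qed.

Lemma mabs_eq0 a : mabs a = 0%N -> a = Defs.mzero.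
Proof.
move=> /eqP; rewrite /mabs sum_nat_seq_eq0 => /allP a0.
apply/fsfunP => p; rewrite fsfun0E; case: (boolP (p \in finsupp a)).
  by move=> /a0 /eqP.
exact: fsfun_dflt.
Qed.

Lemma mfact0 : mfact Defs.mzero = 1%N.
Proof. by rewrite /mfact finsupp0 big_nil. Qed.

(** [charset a] is a permutation of the list repeating each [p] exactly [a p] times. This links the
    recursion for [Fn], a sum over [charset a], to the propagator, a sum over the support. *)
Lemma big_charset (V : zmodType) (a : mindex) (G : nat * nat -> V) :
  \sum_(p <- charset a) G p = \sum_(p <- finsupp a) G p *+ a p.
Proof.
rewrite /charset (perm_big _ (permEl (perm_sort _ _))) big_flatten big_map /=.
by apply: eq_bigr => p _; rewrite big_nseq iter_addr addr0.
Qed.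

End MultiIndices.

(** * The solution operator *)

Section IntegrableOnInterval.
Context {R : realType} {T : R}.
Local Notation mu := (@lebesgue_measure R).
Local Notation I := `]0%R, T[%classic.

Lemma lmeasurable_itv (i : interval R) : @measurable _ (measurableTypeR R) [set` i].
Proof. exact: (measurable_itv i). Qed.

Lemma L1_lin (Y : normedModType R) (a : R) (f g : R -> Y) :
  L1 T f -> L1 T g -> L1 T (fun s => a *: f s + g s).
Proof. by apply: bochner_integrable_lin; exact: lmeasurable_itv. Qed.

Lemma L1_zero (Y : normedModType R) : L1 T (fun=> 0 : Y).
Proof. by apply: bochner_integrable0; exact: lmeasurable_itv. Qed.

Lemma L1_scale (Y : normedModType R) (a : R) (f : R -> Y) :
  L1 T f -> L1 T (fun s => a *: f s).
Proof.
move=> Lf; have := L1_lin a Lf (L1_zero Y).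
by congr L1; apply/funext => s; rewrite addr0.
Qed.

Lemma L1_sum (Y : normedModType R) (J : eqType) (r : seq J) (F : J -> R -> Y) :
  (forall j, j \in r -> L1 T (F j)) -> L1 T (fun s => \sum_(j <- r) F j s).
Proof.
elim: r => [_|j r IH LF].
  by under eq_fun do rewrite big_nil; exact: L1_zero.
have LFr : L1 T (fun s => \sum_(j <- r) F j s).
  by apply: IH => k kr; apply: LF; rewrite inE kr orbT.
have := L1_lin 1 (LF j (mem_head _ _)) LFr.
by congr L1; apply/funext => s; rewrite big_cons scale1r.
Qed.

Lemma ae_equal_sum (Y : zmodType) (J : eqType) (r : seq J) (F G : J -> R -> Y) :
  (forall j, j \in r -> ae_equal I (F j) (G j)) ->
  ae_equal I (fun s => \sum_(j <- r) F j s) (fun s => \sum_(j <- r) G j s).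
Proof.
elim: r => [_|j r IH FG]; first by apply: ae_onW => t _; rewrite !big_nil.
apply: ae_onS2 (FG j (mem_head _ _)) (IH _) => [t _ h1 h2|k kr].
  by rewrite !big_cons h1 h2.
by apply: FG; rewrite inE kr orbT.
Qed.

(** The equations integrate over [[0, t]], while [L1] and null sets refer to the open interval; they
    differ only by the point [0]. *)
Lemma itv_closed_sub_open (t : R) : I t -> `[0, t]%classic `\` [set 0] `<=` I.
Proof.
move=> /=; rewrite in_itv /= => /andP[t0 tT] s [] /=; rewrite !in_itv /=.
move=> /andP[s0 st] /eqP sn0; rewrite lt_neqAle eq_sym sn0 s0 /=.
exact: le_lt_trans tT.
Qed.

Lemma L1_itv (Y : normedModType R) (f : R -> Y) t :
  I t -> L1 T f -> bochner_integrable `[0, t]%classic f.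
Proof.
move=> It Lf; apply: (bochner_integrable_sub (N := [set 0]) _ _ _ _ _ Lf) => //.
- exact: lebesgue_measure_set1.
- exact: itv_closed_sub_open.
Qed.

Lemma ae_equal_itv (Y : Type) (f g : R -> Y) t :
  I t -> ae_equal I f g -> ae_equal `[0, t]%classic f g.
Proof.
move=> It [N [mN N0 sN]]; exists (N `|` [set 0]); split.
- by apply: measurableU.
- by apply: null_set_setU => //; exact: lebesgue_measure_set1.
- move=> s /=; have [->|s0] := eqVneq s 0; first by right.
  move=> /not_implyP[st fg]; left; apply: sN => /= h; apply: fg; apply: h.
  by apply: (itv_closed_sub_open It); split => //=; exact/eqP.
Qed.

Lemma mu_itv_fin (t : R) : (mu `[0%R, t]%classic < +oo)%E.
Proof. by rewrite lebesgue_measure_itv /=; case: ifP => _; rewrite ltry. Qed.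

Lemma bint_itv_lin (Y : completeNormedModType R) (a : R) (f g : R -> Y) t :
  I t -> L1 T f -> L1 T g ->
  bint `[0, t]%classic (fun s => a *: f s + g s) =
  a *: bint `[0, t]%classic f + bint `[0, t]%classic g.
Proof.
move=> It Lf Lg; apply: bint_lin; [exact: lmeasurable_itv|exact: mu_itv_fin|..];
  exact: L1_itv.
Qed.

Lemma bint_itv_ae (Y : completeNormedModType R) (f g : R -> Y) t :
  I t -> ae_equal I f g -> bint `[0, t]%classic f = bint `[0, t]%classic g.
Proof.
by move=> It fg; apply: bint_ae; [exact: lmeasurable_itv|exact: ae_equal_itv].
Qed.

Lemma bint_itv0 (Y : completeNormedModType R) t :
  I t -> bint `[0, t]%classic (fun=> 0 : Y) = 0.
Proof.
move=> It; have := bint_itv_lin (-1) It (L1_zero Y) (L1_zero Y).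
by rewrite scaler0 addr0 scaleN1r addNr.
Qed.

(** Linearity is given for [a *: v1 + v2]; homogeneity follows once [Op 0 = 0] almost everywhere,
    the case [a = -1], [v1 = v2 = 0]. *)
Lemma L1_operator_scale (Y Z : completeNormedModType R)
    (Op : (R -> Y) -> (R -> Z)) (c : R) v :
  L1_operator T Op -> L1 T v ->
  ae_equal I (Op (fun s => c *: v s)) (fun s => c *: Op v s).
Proof.
move=> [_ _ lin] Lv; have L0 := L1_zero Y.
have Op0 : ae_equal I (Op (fun=> 0)) (fun=> 0).
  have := lin (-1) _ _ L0 L0.
  rewrite [in X in ae_equal _ X](_ : (fun s => _) = (fun=> 0)).
    by move=> h; apply: ae_onS h => t _ ->; rewrite scaleN1r addNr.
  by apply/funext => s; rewrite scaler0 addr0.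
have := lin c _ _ Lv L0.
rewrite [in X in ae_equal _ X](_ : (fun s => _) = (fun s => c *: v s)).
  by move=> h; apply: ae_onS2 h Op0 => t _ -> ->; rewrite addr0.
by apply/funext => s; rewrite addr0.
Qed.

End IntegrableOnInterval.

(** * Linearity of the solution operator *)

Section SolutionOperator.
Context {R : realType} {A X U : completeNormedModType R}.
Context {iA : {linear A -> X}} {iU : {linear U -> X}} {T : R}.
Context {Aop : (R -> A) -> (R -> X)} {V : U -> (R -> X) -> (R -> A)}.
Context (Aop_lin : L1_operator T Aop) (HV : solution_operator iA iU T Aop V).
Local Notation I := `]0%R, T[%classic.

Lemma wsol_lin (a : R) v0 w0 phi psi v w : L1 T phi -> L1 T psi ->
  wsol iA iU T Aop v0 phi v -> wsol iA iU T Aop w0 psi w ->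
  wsol iA iU T Aop (a *: v0 + w0) (fun s => a *: phi s + psi s)
    (fun s => a *: v s + w s).
Proof.
have [AL _ Alin] := Aop_lin.
move=> Lphi Lpsi [Lv ev] [Lw ew]; split; first exact: L1_lin.
apply: ae_onS2 ev ew => t It ev ew.
rewrite linearP /= ev ew (bint_itv_ae It (Alin a v w Lv Lw)).
rewrite !(bint_itv_lin _ It)//; [|exact: AL|exact: AL].
rewrite linearP /= !scalerDr.
by rewrite [LHS]addrACA; congr (_ + _); rewrite addrACA.
Qed.

Lemma V_L1 v0 phi : L1 T phi -> L1 T (V v0 phi).
Proof. by move=> /(HV v0) [[]]. Qed.

Lemma V_unique v0 phi v : L1 T phi ->
  wsol iA iU T Aop v0 phi v -> ae_equal I v (V v0 phi).
Proof. by move=> Lphi; exact: (HV v0 Lphi).2. Qed.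

(** The combination of two solutions solves the equation with the combined data, and uniqueness
    identifies it. *)
Lemma V_lin (a : R) v0 w0 phi psi : L1 T phi -> L1 T psi ->
  ae_equal I (fun s => a *: V v0 phi s + V w0 psi s)
    (V (a *: v0 + w0) (fun s => a *: phi s + psi s)).
Proof.
move=> Lphi Lpsi; apply: V_unique; first exact: L1_lin.
by apply: wsol_lin => //; [exact: (HV v0 Lphi).1|exact: (HV w0 Lpsi).1].
Qed.

Lemma V_zero : ae_equal I (V 0 (fun=> 0)) (fun=> 0).
Proof.
have := V_lin (-1) 0 0 (L1_zero X) (L1_zero X).
rewrite scaler0 addr0 [in X in ae_equal _ _ X](_ : (fun s => _) = (fun=> 0)); last first.
  by apply/funext => s; rewrite scaler0 addr0.
by move=> h; apply: ae_onS h => t _ <-; rewrite scaleN1r addNr.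
Qed.

Lemma V_sum (J : eqType) (r : seq J) (c : J -> R) (psi : J -> R -> X) :
  (forall j, j \in r -> L1 T (psi j)) ->
  ae_equal I (fun s => \sum_(j <- r) c j *: V 0 (psi j) s)
    (V 0 (fun s => \sum_(j <- r) c j *: psi j s)).
Proof.
elim: r => [_|j r IH Lpsi].
  rewrite (_ : (fun s => \sum_(j <- [::]) c j *: psi j s) = (fun=> 0)).
    by apply: ae_onS V_zero => t _ ->; rewrite big_nil.
  by apply/funext => s; rewrite big_nil.
have Lr k : k \in r -> L1 T (psi k).
  by move=> kr; apply: Lpsi; rewrite inE kr orbT.
have Lj := Lpsi j (mem_head _ _).
have := V_lin (c j) 0 0 Lj (L1_sum (fun k kr => L1_scale (c k) (Lr k kr))).
rewrite scaler0 addr0.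
rewrite [in X in ae_equal _ _ X](_ : (fun s => _) =
    (fun s => \sum_(k <- j :: r) c k *: psi k s)); last first.
  by apply/funext => s; rewrite big_cons.
apply: ae_equal_trans.
by apply: ae_onS (IH Lr) => t _ <-; rewrite big_cons.
Qed.

End SolutionOperator.

(** * Induction on the order of the multi-index *)

Theorem theorem6p5 (R : realType) (A X U : completeNormedModType R)
  (iA : {linear A -> X}) (iU : {linear U -> X})
  (iA_inj : injective iA) (iU_inj : injective iU)
  (T : R) (T_gt0 : 0 < T)
  (m : nat -> R -> R) (m_basis : ONB_Linfty T m)
  (Aop : (R -> A) -> (R -> X)) (Mop : nat -> (R -> A) -> (R -> X))
  (Aop_lin : L1_operator T Aop) (Mop_lin : forall k, L1_operator T (Mop k))
  (u0 : mindex -> U) (f : mindex -> R -> X) (g : nat -> mindex -> R -> X)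
  (f_L1 : forall a, L1 T (f a)) (g_L1 : forall k a, L1 T (g k a))
  (V : U -> (R -> X) -> (R -> A))
  (HV : solution_operator iA iU T Aop V)
  (Hg : forall k a, ae_equal `]0%R, T[%classic (g k a) (fun=> 0))
  (Hf : forall a, (0 < mabs a)%N -> ae_equal `]0%R, T[%classic (f a) (fun=> 0))
  (Hu0 : forall a, (0 < mabs a)%N -> u0 a = 0)
  (u : mindex -> R -> A)
  (Hu : wc_solution iA iU T Aop Mop m u0 f g u) :
  forall a : mindex, (0 < mabs a)%N ->
    ae_equal `]0%R, T[%classic (u a)
      (fun t => (Num.sqrt ((mfact a)%:R : R))^-1 *: Fn V Mop m u0 f (mabs a) a t).
Proof.
pose I : set R := `]0%R, T[%classic.
(* Since [m_i] is essentially bounded, the forcing terms of the recursion are integrable and [V]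
   solves the equation with them. *)
have MF_L1 p v : L1 T v -> L1 T (fun s => m p.1 s *: Mop p.2 v s).
  move=> Lv; have [mm mC _ _] := m_basis; have [C mpC] := mC p.1.
  apply: (bochner_integrable_scale (C := C)) => //.
  by have [ML _ _] := Mop_lin p.2; exact: ML.
have Fn_L1 n a : L1 T (Fn V Mop m u0 f n a).
  elim: n a => [|n IH] a /=; first exact: (V_L1 HV).
  by apply: L1_sum => p _; apply: (V_L1 HV); exact: MF_L1.
(* Including order [0], where [Fn] is [V] applied to the data of the zero index, lets the induction
   start at [u_(0)]. *)
suff main n a : mabs a = n ->
    ae_equal I (u a) (fun t => (Num.sqrt ((mfact a)%:R : R))^-1 *: Fn V Mop m u0 f n a t).
  by move=> a _; exact: main.
elim: n a => [a /mabs_eq0 ->|n IH a an].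
  rewrite mfact0 sqrtr1 invr1.
  suff : wsol iA iU T Aop (u0 Defs.mzero) (f Defs.mzero) (u Defs.mzero).
    move=> /(V_unique HV (f_L1 Defs.mzero)) h.
    by apply: ae_onS h => t _ ->; rewrite scale1r.
  have [Lu eu] := Hu Defs.mzero; split => //.
  apply: ae_onS eu => t It ->.
  have -> : bint `[0, t]%classic (fun s => Aop (u Defs.mzero) s + f Defs.mzero s) =
      bint `[0, t]%classic (Aop (u Defs.mzero)) + bint `[0, t]%classic (f Defs.mzero).
    have [AL _ _] := Aop_lin.
    rewrite -[in RHS](scale1r (bint _ (Aop _))) -(bint_itv_lin _ It)//; last exact: AL.
    by congr bint; apply/funext => s; rewrite scale1r.
  rewrite (_ : bint _ (fun s => \sum_(p <- _) _) = 0) ?addr0 ?addrA//.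
  rewrite -[RHS](bint_itv0 X It); congr bint; apply/funext => s.
  by rewrite finsupp0 big_nil.
have a0 : (0 < mabs a)%N by rewrite an.
pose psi p s := m p.1 s *: Mop p.2 (Fn V Mop m u0 f n (mdec a p)) s.
(* [a p] is the multiplicity of [p] in the characteristic set, and the root of [a!] is the
   normalization in the claim. *)
pose c p := (Num.sqrt ((mfact a)%:R : R))^-1 * (a p)%:R.
have Lpsi p : L1 T (psi p) by exact: MF_L1.
pose phi s := \sum_(p <- finsupp a) c p *: psi p s.
have Lphi : L1 T phi by apply: L1_sum => p _; exact: L1_scale.
have phiE : ae_equal I (fun s => \sum_(p <- finsupp a)
    (Num.sqrt ((a p)%:R : R) * m p.1 s) *:
      (Mop p.2 (u (mdec a p)) s + g p.2 (mdec a p) s)) phi.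
  apply: ae_equal_sum => p pa.
  have [ML Mae _] := Mop_lin p.2.
  (* The induction hypothesis holds only almost everywhere; it passes through [Mop] because the
     operator respects almost everywhere equality, and then the scalar is pulled out. *)
  have := IH (mdec a p); rewrite (mabs_mdec pa) in an; case: an => -> /(_ erefl) ua.
  have /ae_equal_trans/(_ (L1_operator_scale _ (Mop_lin p.2) (Fn_L1 n (mdec a p)))) Mu :=
    Mae _ _ (Hu (mdec a p)).1 (L1_scale _ (Fn_L1 n (mdec a p))) ua.
  apply: ae_onS2 Mu (Hg p.2 (mdec a p)) => t _ -> ->.
  rewrite addr0 /c /psi !scalerA; congr (_ *: _).
  rewrite (mfact_mdec pa) natrM sqrtrM//.
  have x0 : Num.sqrt ((a p)%:R : R) != 0.
    by rewrite gt_eqF// sqrtr_gt0 ltr0n lt0n -mem_finsupp.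
  have y0 : Num.sqrt ((mfact (mdec a p))%:R : R) != 0.
    by rewrite gt_eqF// sqrtr_gt0 ltr0n mfact_gt0.
  (* Writing [a p] as the square of its root leaves a rational identity in the two nonzero roots of
     [a p] and of the factorial of [mdec a p]. *)
  rewrite -[X in _ = _ * X * _](@sqr_sqrtr R (a p)%:R)//.
  by field; rewrite x0 y0.
(* For positive order the initial value is zero and [f a] vanishes almost everywhere, so the
   propagator is the deterministic equation with forcing [phi]. *)
have uphi : ae_equal I (u a) (V 0 phi).
  apply: (V_unique HV Lphi); have [Lu eu] := Hu a; split => //.
  apply: ae_onS eu => t It ->; rewrite Hu0//.
  rewrite (bint_itv_ae It phiE); congr (_ + _ + _).
  apply: (bint_itv_ae It).
  by apply: ae_onS (Hf a a0) => s _ ->; rewrite addr0.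
apply: (ae_equal_trans uphi).
have := ae_equal_sym (V_sum Aop_lin HV c (fun p (_ : p \in (finsupp a : seq _)) => Lpsi p)).
apply: ae_onS => t _ ->.
(* The factor [a p] in [c p] is absorbed as the multiplicity of [p] in the sum over [charset a]. *)
rewrite /= big_charset scaler_sumr; apply: eq_bigr => p _.
by rewrite -scalerMnr scalerMnl -[_ *+ a p]mulr_natr.
Qed.
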